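(* Let $\mathbb{T}$ be any time scale and let $f:[\alpha_1,\alpha_2]_{\mathbb{T}}\to[\beta_1,\beta_2]_{\widetilde{\mathbb{T}}}$ be a continuous strictly increasing function, where the image $\widetilde{\mathbb{T}}$ of $f$ is also a time scale. Then for every $a,\widehat{a}\in[\alpha_1,\alpha_2]_{\mathbb{T}}$ and $b,\widehat{b}\in[\beta_1,\beta_2]_{\widetilde{\mathbb{T}}}$ we have $$ \left(f^{-1}(\widehat{b})-\widehat{a}\right)\left(f(\rho(\widehat{a}))-\widehat{b}\right) \le \int_{\widehat{a}}^a f(t)\,\Delta t + \int_{\widehat{b}}^b f^{-1}(y)\,\widetilde{\nabla} y - ab + \widehat{a}\widehat{b} \le \left(f^{-1}(b)-a\right)\left(b-f(\rho(a))\right), $$ where the equalities hold if and only if $\widehat{b}\in\{f(\rho(\widehat{a})),f(\widehat{a})\}$ and $b\in\{f(\rho(a)),f(a)\}$. The inequalities are reversed if $f$ is strictly decreasing.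
   Context: A time scale is a nonempty closed subset of $\mathbb{R}$; intervals with a subscript denote intersections, e.g. $[\alpha_1,\alpha_2]_{\mathbb{T}}=[\alpha_1,\alpha_2]\cap\mathbb{T}$. Here $\alpha_1<\alpha_2$ are points of $\mathbb{T}$ and $\widetilde{\mathbb{T}}=f([\alpha_1,\alpha_2]_{\mathbb{T}})$. The jump operators of $\mathbb{T}$ are $\sigma(t)=\inf\{s\in\mathbb{T}:s>t\}$ and $\rho(t)=\sup\{s\in\mathbb{T}:s<t\}$, with $\sigma(\max\mathbb{T})=\max\mathbb{T}$ and $\rho(\min\mathbb{T})=\min\mathbb{T}$. So that $f(\rho(\alpha_1))$ is meaningful, $f$ is understood to be defined also at $\rho(\alpha_1)$, being continuous and strictly monotone (in the same sense) on $[\rho(\alpha_1),\alpha_2]_{\mathbb{T}}$. The delta and nabla derivatives are $h^\Delta(t)=\lim_{s\to t}\frac{h(\sigma(t))-h(s)}{\sigma(t)-s}$ and $h^\nabla(t)=\lim_{s\to t}\frac{h(\rho(t))-h(s)}{\rho(t)-s}$. For continuous $h$, $\int_r^s h(t)\,\Delta t=H(s)-H(r)$ where $H^\Delta=h$, and $\int_r^s h(t)\,\nabla t=H(s)-H(r)$ where $H^\nabla=h$; integrals are oriented ($\int_r^s=-\int_s^r$). The symbol $\widetilde{\nabla}$ denotes nabla integration on the time scale $\widetilde{\mathbb{T}}$, and $\Delta$ denotes delta integration on $\mathbb{T}$.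
   Formalization: For strictly decreasing f the integral of f^{-1} over the image time scale is taken as a delta integral instead of a nabla integral, because with nabla the reversed inequalities fail (T={0,1}, f(t)=1-t); ''the equalities hold'' means that both hold together. *)

(* Defs.v *)
From mathcomp Require Import all_boot all_order all_algebra.
From mathcomp Require Import all_classical all_reals all_analysis.
Import Order.TTheory GRing.Theory Num.Theory.
Import numFieldNormedType.Exports.

Set Implicit Arguments.
Unset Strict Implicit.
Unset Printing Implicit Defensive.

Local Open Scope classical_set_scope.
Local Open Scope ring_scope.

Definition time_scale (R : realType) (T : set R) : Prop :=
  T !=set0 /\ closed T.

Definition ts_itv (R : realType) (T : set R) (r s : R) : set R :=
  T `&` `[r, s]%classic.

(* When t is in T, the set [T `&` [set s | t < s]] is empty exactly when
   t = max T; the explicit test is needed because [inf set0 = 0]. *)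
Definition sigma (R : realType) (T : set R) (t : R) : R :=
  let A := T `&` [set s | t < s] in if `[< A = set0 >] then t else inf A.

Definition rho (R : realType) (T : set R) (t : R) : R :=
  let A := T `&` [set s | s < t] in if `[< A = set0 >] then t else sup A.

(* The limit s --> t ranges over the s in T for which the quotient makes sense,
   i.e. s != sigma T t.  The value s = t is allowed when t is right-scattered
   (it is the only one near t when t is isolated).  When t = max T is
   left-scattered the filter is trivial and the condition is void: this is the
   usual restriction of delta derivatives to T^kappa.  Only the values of h on
   T matter.  Symmetrically for nabla. *)
Definition is_delta_derive (R : realType) (T : set R) (h : R -> R) (t l : R) :
    Prop :=
  (h (sigma T t) - h s) / (sigma T t - s)
    @[s --> within (T `\ sigma T t) (nbhs t)] --> l.

Definition is_nabla_derive (R : realType) (T : set R) (h : R -> R) (t l : R) :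
    Prop :=
  (h (rho T t) - h s) / (rho T t - s)
    @[s --> within (T `\ rho T t) (nbhs t)] --> l.

(* H is only required to be an antiderivative of h between the bounds of
   integration, since the integrands need not be defined on all of T.  Taking
   [Num.min] and [Num.max] of the bounds makes the integrals oriented.  The
   default [cst 0] is used only if h has no antiderivative. *)
Definition delta_int (R : realType) (T : set R) (h : R -> R) (r s : R) : R :=
  let H := xget (cst 0) [set H : R -> R |
    forall t, ts_itv T (Num.min r s) (Num.max r s) t ->
      is_delta_derive T H t (h t)] in
  H s - H r.

Definition nabla_int (R : realType) (T : set R) (h : R -> R) (r s : R) : R :=
  let H := xget (cst 0) [set H : R -> R |
    forall t, ts_itv T (Num.min r s) (Num.max r s) t ->
      is_nabla_derive T H t (h t)] in
  H s - H r.

(* A strictly increasing continuous f carries the backward jump of T to the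
   backward jump of its image: away from the left end point,
   rho (f @` A) (f t) = f (rho T t).  A strictly decreasing f carries it to the
   forward jump: sigma (f @` A) (f t) = f (rho T t).  Hence the integral of
   f^-1 over the image that enters Young's inequality is [nabla_int] when f is
   increasing and [delta_int] when f is decreasing.  With [nabla_int] the
   decreasing case is false: for T = {0, 1} and f t = 1 - t, from
   (0, 1) to (1, 0), both bounds are 0 but the middle term is 1. *)

(* Main.v *)
Require Import Defs.
From mathcomp Require Import all_boot all_order all_algebra.
From mathcomp Require Import all_classical all_reals all_analysis.
From mathcomp Require Import measurable_realfun ring lra.
Import Order.TTheory GRing.Theory Num.Theory.
Import numFieldNormedType.Exports.

Local Open Scope classical_set_scope.
Local Open Scope ring_scope.

(* For increasing f let F and G be antiderivatives of f and of f^-1, and put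
   W(a, b) = F a + G b - a b, so that the middle term is W(a, b) - W(ah, bh).
   Integration by parts: W(t, f t) is a constant m, because its increment over
   [s, t] is at most (t - s) (f t - f s) and its increments over forward jumps
   vanish.  Bounding F a - F t for b = f t between the extreme values of f then
   gives 0 <= W(a, b) - m <= (f^-1 b - a) (b - f (rho a)), and the theorem is
   the difference of these bounds at (a, b) and (ah, bh).  The decreasing case
   is the increasing one for - f and the reflected image. *)

(** * Jump operators *)

Section JumpOperators.
Context {R : realType}.
Set Implicit Arguments.
Unset Strict Implicit.
Implicit Types (T B : set R) (h F H : R -> R) (r s t x y l : R).

Lemma oppsetE T x : [set - y | y in T] x = T (- x).
Proof.
apply/propext; split=> [[y Ty <-]|Tx]; rewrite ?opprK//.
by exists (- x); rewrite ?opprK.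
Qed.

Lemma closed_sup_sub T B :
  closed T -> B `<=` T -> B !=set0 -> has_ubound B -> T (sup B).
Proof.
move=> cT BT B0 Bub; apply: cT; apply: closureS BT _ _.
exact: closure_sup.
Qed.

Lemma closed_inf_sub T B :
  closed T -> B `<=` T -> B !=set0 -> has_lbound B -> T (inf B).
Proof.
move=> cT BT B0 Blb; rewrite /inf -oppsetE; apply: closed_sup_sub.
- exact: closedN.
- by move=> _ [x Bx <-]; exists x => //; exact: BT.
- exact/nonemptyN.
- exact/has_lb_ubN.
Qed.

(** Reflection through 0 exchanges the two jumps. The basic facts on [rho], and later those on nabla
    derivatives, are transported from their forward twins by this equation. *)
Lemma sigma_opp T t : sigma [set - x | x in T] (- t) = - rho T t.
Proof.
rewrite /sigma /rho.
have -> : [set - x | x in T] `&` [set s | - t < s] =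
    [set - x | x in T `&` [set s | s < t]].
  apply/seteqP; split=> [x [Tx /= tx]|x].
    rewrite oppsetE in Tx; exists (- x); last by rewrite opprK.
    by split=> //=; lra.
  rewrite oppsetE => -[Tx /= xt]; split; last by rewrite /=; lra.
  by exists (- x); rewrite ?opprK.
case: (pselect (T `&` [set s | s < t] = set0)) => [E|E].
  by rewrite !asboolT// E image_set0.
rewrite !asboolF//.
  rewrite /inf; congr (- sup _).
  by apply/seteqP; split=> x; rewrite !oppsetE opprK.
by move=> /image_set0_set0.
Qed.

Lemma rho_opp T t : rho [set - x | x in T] (- t) = - sigma T t.
Proof.
have := sigma_opp [set - x | x in T] (- t); rewrite opprK => /(canLR opprK) <-.
by congr (- sigma _ _); apply/seteqP; split=> x; rewrite !oppsetE opprK.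
Qed.

Lemma sigma_ge T t : t <= sigma T t.
Proof.
rewrite /sigma; case: asboolP => // /eqP/set0P ne.
by apply: lb_le_inf => // x [_ /ltW].
Qed.

Lemma sigma_in T t : closed T -> T t -> T (sigma T t).
Proof.
move=> cT Tt; rewrite /sigma; case: asboolP => // /eqP/set0P ne.
apply: closed_inf_sub => //.
by exists t => x [_ /ltW].
Qed.

Lemma sigma_le T t s : T s -> t < s -> sigma T t <= s.
Proof.
move=> Ts ts; rewrite /sigma; case: asboolP => [E|_].
  by have : set0 s by rewrite -E.
by apply: ge_inf => //; exists t => x [_ /ltW].
Qed.

Lemma sigma_dense T t s d : T s -> t < s -> sigma T t = t -> 0 < d ->
  exists2 x, T x & t < x < t + d.
Proof.
move=> Ts ts; rewrite /sigma; case: asboolP => [E|_].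
  by have : set0 s by rewrite -E.
move=> Ei d0; have : has_inf (T `&` [set s | t < s]).
  by split; [exists s|exists t => x [_ /ltW]].
move=> /(inf_adherent d0)[x [Tx /= tx]]; rewrite Ei => xd.
by exists x; rewrite ?tx.
Qed.

Lemma rho_le T t : rho T t <= t.
Proof. by rewrite -(opprK (rho T t)) -sigma_opp lerNl sigma_ge. Qed.

Lemma rho_in T t : closed T -> T t -> T (rho T t).
Proof.
move=> cT Tt; rewrite -(opprK (rho T t)) -oppsetE -sigma_opp.
apply: sigma_in; first exact: closedN.
by exists t.
Qed.

Lemma rho_ge T t s : T s -> s < t -> s <= rho T t.
Proof.
move=> Ts st; rewrite -lerN2 -sigma_opp; apply: sigma_le; first by exists s.
by rewrite ltrN2.
Qed.

Lemma rho_dense T t s d : T s -> s < t -> rho T t = t -> 0 < d ->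
  exists2 x, T x & t - d < x < t.
Proof.
move=> Ts st rt d0.
have [| | | |x] := @sigma_dense [set - x | x in T] (- t) (- s) d.
- by exists s.
- by rewrite ltrN2.
- by rewrite sigma_opp rt.
- by [].
rewrite oppsetE => Tx /andP[x1 x2]; exists (- x) => //; lra.
Qed.

(** A forward jump from [rho T t] that stopped short of [t] would stay at [rho T t] by maximality of
    the latter. Then [rho T t] would be right-dense, and a point of [T] just after it would
    contradict [rho_ge]. *)
Lemma sigma_rho T t : closed T -> T t -> rho T t < t -> sigma T (rho T t) = t.
Proof.
move=> cT Tt rt; apply/eqP; rewrite eq_le sigma_le//= leNgt; apply/negP => st.
have sr : sigma T (rho T t) = rho T t.
  apply/eqP; rewrite eq_le sigma_ge andbT; apply: rho_ge => //.
  by apply: sigma_in => //; exact: rho_in.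
have d0 : 0 < t - rho T t by rewrite subr_gt0.
have [x Tx] := sigma_dense Tt rt sr d0.
by rewrite subrKC => /andP[rx /(rho_ge Tx)]; rewrite leNgt rx.
Qed.

Lemma rho_sigma T t : closed T -> T t -> t < sigma T t -> rho T (sigma T t) = t.
Proof.
move=> cT Tt ts; have Ts := sigma_in cT Tt; apply/eqP.
rewrite eq_le rho_ge// andbT leNgt; apply/negP => tr.
have rs : rho T (sigma T t) = sigma T t.
  apply/eqP; rewrite eq_le rho_le/=; apply: sigma_le => //; exact: rho_in.
have d0 : 0 < sigma T t - t by rewrite subr_gt0.
have [x Tx] := rho_dense Tt ts rs d0.
by rewrite subKr => /andP[/(sigma_le Tx)]; rewrite leNgt => /negbTE ->.
Qed.

(* Induction on a time scale: the infimum of the counterexamples is either a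
   counterexample, reached by a forward jump or as a limit from the left, or
   right-dense. *)
Lemma time_scale_induction T s t (P : R -> Prop) :
  closed T -> T s -> T t -> s <= t -> P s ->
  (forall x, T x -> s <= x < t -> x < sigma T x -> P x -> P (sigma T x)) ->
  (forall x, T x -> s <= x < t -> sigma T x = x -> P x ->
     exists2 d : R, 0 < d & forall y, T y -> x < y < x + d -> P y) ->
  (forall x, T x -> s < x <= t ->
     (forall d : R, 0 < d -> exists y, [/\ T y, s <= y, x - d < y & y < x]) ->
     (forall y, T y -> s <= y < x -> P y) -> P x) ->
  P t.
Proof.
move=> cT Ts Tt st Ps jump right left; apply: contrapT => nPt.
pose B := [set x | [/\ T x, s <= x <= t & ~ P x]].
have Bt : B t by split; rewrite ?st ?lexx.
have Bs : lbound B s by move=> x [_ /andP[]].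
have hB : has_inf B by split; [exists t|exists s].
set c := inf B.
have sc : s <= c by apply: lb_le_inf; [exists t|].
have ct : c <= t by apply: ge_inf => //; exists s.
have Tc : T c by apply: closed_inf_sub => //; [move=> x [] | exists t | exists s].
have good y : T y -> s <= y < c -> P y.
  move=> Ty /andP[sy yc]; apply: contrapT => nPy.
  have : c <= y.
    by apply: ge_inf; [exists s|split; rewrite ?sy//= (le_trans (ltW yc))].
  by rewrite leNgt yc.
(* If [P c] holds, [c] is a limit from the right of counterexamples, hence right-dense, and [right]
   excludes counterexamples near it. *)
have [Pc|nPc] := pselect (P c).
  have cB d : 0 < d -> exists2 x, B x & c < x < c + d.
    move=> d0; have [x Bx xd] := inf_adherent d0 hB; exists x => //.
    rewrite xd andbT lt_neqAle ge_inf ?andbT//; last by exists s.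
    by apply/eqP => cx; case: Bx => _ _; rewrite -cx.
  have sigc : sigma T c = c.
    apply/eqP; rewrite eq_le sigma_ge andbT leNgt; apply/negP => cs.
    have [|x [Tx _ _]] := cB (sigma T c - c); first by rewrite subr_gt0.
    by rewrite subrKC => /andP[/(sigma_le Tx)]; rewrite leNgt => /negbTE ->.
  have ltct : c < t.
    by rewrite lt_neqAle ct andbT; apply/eqP => E; apply: nPt; rewrite -E.
  have [|d d0 dP] := right c Tc _ sigc Pc; first by rewrite sc.
  by have [x [Tx _ nPx] /(dP _ Tx)] := cB d d0.
apply: (nPc); have {}sc : s < c.
  by rewrite lt_neqAle sc andbT; apply/eqP => E; apply: nPc; rewrite -E.
have := rho_le T c; rewrite le_eqVlt => /predU1P[rc|rc].
  apply: left => //; first by rewrite sc.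
  move=> d d0.
  (* Capping the radius by [c - s] keeps [y] to the right of [s]. *)
  have [|y Ty /andP[y1 y2]] := @rho_dense T c s (Num.min d (c - s)) Ts sc rc.
    by rewrite lt_min d0 subr_gt0.
  exists y; split=> //; move: y1.
    by rewrite ltrBlDr -ltrBlDl lt_min => /andP[_]; lra.
  by rewrite ltrBlDr -ltrBlDl lt_min => /andP[+ _]; lra.
rewrite -(sigma_rho cT Tc rc); have sr := rho_ge Ts sc.
apply: jump; rewrite ?sigma_rho ?sr ?(lt_le_trans rc)//; first exact: rho_in.
by apply: good; rewrite ?sr//; exact: rho_in.
Qed.

End JumpOperators.

(** * Antiderivatives and integrals *)

Section Antiderivatives.
Context {R : realType}.
Set Implicit Arguments.
Unset Strict Implicit.
Implicit Types (T B : set R) (h F H : R -> R) (r s t x y l : R).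

(** Once the denominator is cleared, the estimate is trivial at [s = p], so the puncture of the
    filter disappears. *)
Lemma within_slope_cvgP T h (p t l : R) :
  (h p - h s) / (p - s) @[s --> within (T `\ p) (nbhs t)] --> l <->
  forall e : R, 0 < e -> exists2 d : R, 0 < d & forall s, T s -> `|s - t| < d ->
    `|h p - h s - l * (p - s)| <= e * `|p - s|.
Proof.
have slopeE s : s != p ->
    `|h p - h s - l * (p - s)| = `|l - (h p - h s) / (p - s)| * `|p - s|.
  move=> sp; rewrite -normrM -normrN; congr `|_|; field.
  by rewrite subr_eq0 eq_sym.
split=> [/cvgrPdist_le lim e e0|lim].
  have := lim e e0; rewrite near_withinE => /nbhs_ballP[d /= d0 dP].
  exists d => // s Ts st; have [->|sp] := eqVneq s p.
    by rewrite !subrr mulr0 subr0 normr0 mulr0.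
  rewrite slopeE// ler_wpM2r//; apply: dP; first by rewrite /ball/= distrC.
  by split=> //; apply/eqP.
apply/cvgrPdist_le => e e0; rewrite near_withinE.
have [d d0 dP] := lim e e0; apply/nbhs_ballP; exists d => //= s.
rewrite /ball/= distrC => st [Ts /eqP sp].
have := dP s Ts st; rewrite slopeE// ler_pM2r// normr_gt0 subr_eq0.
by rewrite eq_sym.
Qed.

Lemma is_nabla_derive_opp T H t l :
  is_nabla_derive T H t l <->
  is_delta_derive [set - x | x in T] (fun x => H (- x)) (- t) (- l).
Proof.
rewrite /is_nabla_derive /is_delta_derive sigma_opp.
have aux x : `|H (rho T t) - H x - l * (rho T t - x)| =
    `|H (rho T t) - H x - - l * (- rho T t - - x)|.
  by congr `|_|; ring.
have auxd x : `|rho T t - x| = `|- rho T t - - x|.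
  by rewrite -normrN; congr `|_|; ring.
have auxt x : `|x - t| = `|- x - - t| by rewrite -normrN; congr `|_|; ring.
split=> /within_slope_cvgP lim; apply/within_slope_cvgP => e e0;
  have [d d0 dP] := lim e e0; exists d => // s.
  rewrite oppsetE => Ts st; have := dP (- s) Ts; rewrite auxt aux auxd !opprK.
  by apply; rewrite opprK in st.
move=> Ts st; rewrite aux auxd -{1}(opprK (rho T t)) -{1}(opprK s).
by apply: dP; [exists s|rewrite -auxt].
Qed.

Lemma is_delta_derive_opp T H t l :
  is_delta_derive T H t l -> is_delta_derive T (fun x => - H x) t (- l).
Proof.
move=> /within_slope_cvgP lim; apply/within_slope_cvgP => e e0.
have [d d0 dP] := lim e e0; exists d => // s Ts st.
rewrite (_ : _ - _ = - (H (sigma T t) - H s - l * (sigma T t - s))); last by ring.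
by rewrite normrN; exact: dP.
Qed.

Lemma is_delta_deriveB T F H t l :
  is_delta_derive T F t l -> is_delta_derive T H t l ->
  is_delta_derive T (fun x => F x - H x) t 0.
Proof.
move=> /within_slope_cvgP Fl /within_slope_cvgP Hl.
apply/within_slope_cvgP => e e0; have e2 : 0 < e / 2 by rewrite divr_gt0.
have [d1 d10 dP1] := Fl _ e2; have [d2 d20 dP2] := Hl _ e2.
exists (Num.min d1 d2); first by rewrite lt_min d10.
move=> s Ts; rewrite lt_min => /andP[s1 s2].
have := dP1 s Ts s1; have := dP2 s Ts s2.
set p := sigma T t => h2 h1.
rewrite (_ : _ - _ = (F p - F s - l * (p - s)) - (H p - H s - l * (p - s)));
  last by ring.
apply: le_trans (ler_normB _ _) _; lra.
Qed.

Lemma le_eps_mul_eq0 (x k : R) :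
  0 <= k -> (forall e : R, 0 < e -> `|x| <= e * k) -> x = 0.
Proof.
move=> k0 xP; apply/eqP; rewrite -normr_le0; apply/ler_addgt0Pl => e e0.
rewrite addr0; have k1 : 0 < k + 1 by lra.
apply: le_trans (xP _ (divr_gt0 e0 k1)) _.
by rewrite mulrAC ler_pdivrMr//; nra.
Qed.

(** Mean value inequality: time scale induction on [|D x - D r| <= e * (x - r)], after which [e]
    tends to 0. *)
Lemma delta_derive0_cst T (D : R -> R) r s :
  closed T -> T r -> T s -> r <= s ->
  (forall t, ts_itv T r s t -> is_delta_derive T D t 0) -> D s = D r.
Proof.
move=> cT Tr Ts rs dD.
have {}dD t : T t -> r <= t <= s -> forall e : R, 0 < e -> exists2 d : R, 0 < d &
    forall x, T x -> `|x - t| < d ->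
    `|D (sigma T t) - D x| <= e * `|sigma T t - x|.
  move=> Tt rts e e0.
  have /dD/within_slope_cvgP/(_ e e0)[d d0 dP] : ts_itv T r s t.
    by split=> //=; rewrite in_itv.
  by exists d => // x Tx /(dP x Tx); rewrite mul0r subr0.
suff lim (e : R) : 0 < e -> `|D s - D r| <= e * (s - r).
  apply/eqP; rewrite -subr_eq0; apply/eqP.
  by apply: (@le_eps_mul_eq0 _ (s - r)) => //; rewrite subr_ge0.
move=> e0; pose P x := `|D x - D r| <= e * (x - r).
have h0 t (d : R) : 0 < d -> `|t - t| < d by rewrite subrr normr0.
suff : P s by [].
apply: (@time_scale_induction _ T r s P) => //.
- by rewrite /P !subrr normr0 mulr0.
- move=> x Tx /andP[rx xs] xsig; rewrite /P => Px.
  have [|d d0 dP] := dD x Tx _ e e0; first by rewrite rx ltW.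
  have := dP x Tx (h0 _ _ d0).
  rewrite (ger0_norm (_ : 0 <= sigma T x - x)); last by lra.
  have := ler_normD (D (sigma T x) - D x) (D x - D r).
  rewrite addrA subrK; lra.
- move=> x Tx /andP[rx xs] sx; rewrite /P => Px.
  have [|d d0 dP] := dD x Tx _ e e0; first by rewrite rx ltW.
  exists d => // y Ty /andP[xy yd].
  have := dP y Ty; rewrite sx (gtr0_norm (_ : 0 < y - x)); last by lra.
  rewrite distrC (distrC x) (gtr0_norm (_ : 0 < y - x)); last by lra.
  have : y - x < d by lra.
  move=> yxd /(_ yxd); have := ler_normD (D y - D x) (D x - D r).
  rewrite addrA subrK /P; lra.
- move=> x Tx /andP[rx xs] left Py; rewrite /P; apply/ler_addgt0Pl => /= u u0.
  (* Since [x] may be right-scattered, [D x] and [D y] are compared through [sigma T x]. This [v]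
     makes the errors [v * (sigma T x - x)] and [v * (sigma T x - y)] add up to at most [u] once
     [x - y < 1]. *)
  have [v vu] : exists v, v * (sigma T x - x + 1) = u / 2.
    by exists (u / (2 * (sigma T x - x + 1))); field; have := sigma_ge T x; lra.
  have v0 : 0 < v by have := sigma_ge T x; nra.
  have [|d d0 dP] := dD x Tx _ v v0; first by rewrite xs ltW.
  have [|y [Ty ry yd yx]] := left (Num.min d 1); first by rewrite lt_min d0 ltr01.
  have [d1 d2] : y - x < 0 /\ `|y - x| < Num.min d 1.
    by split; [|rewrite ltr0_norm]; lra.
  move: d2; rewrite lt_min => /andP[d2 d3].
  have := dP y Ty d2; have := dP x Tx (h0 _ _ d0).
  have := Py y Ty; rewrite ry yx => /(_ isT).
  move: (sigma_ge T x); rewrite ltr0_norm// in d3.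
  move: (sigma T x) vu => p vu xp; rewrite /P.
  rewrite (ger0_norm (_ : 0 <= p - x)); last by lra.
  rewrite (ger0_norm (_ : 0 <= p - y)); last by lra.
  move=> h1 h2 h3.
  have := ler_normD (D y - D r) ((D p - D y) - (D p - D x)).
  have := ler_normB (D p - D y) (D p - D x).
  rewrite (_ : D y - D r + _ = D x - D r); last by ring.
  have : v * (x - y) <= v * 1 by rewrite ler_pM2l//; lra.
  have : e * (y - r) <= e * (x - r) by rewrite ler_pM2l//; lra.
  lra.
Qed.

(** [F] guarantees that [xget] picks a true antiderivative, whose difference from [F] is constant
    between the bounds, in either orientation. *)
Lemma delta_intE T h F r s : closed T -> T r -> T s ->
  (forall t, ts_itv T (Num.min r s) (Num.max r s) t ->
    is_delta_derive T F t (h t)) ->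
  delta_int T h r s = F s - F r.
Proof.
move=> cT Tr Ts dF; rewrite /delta_int.
set H := xget _ _.
have dH t : ts_itv T (Num.min r s) (Num.max r s) t -> is_delta_derive T H t (h t).
  by move: t; rewrite /H; case: xgetP => [? _|/(_ F)/(_ dF)].
move: H dH => H dH.
have dHF t : ts_itv T (Num.min r s) (Num.max r s) t ->
    is_delta_derive T (fun x => H x - F x) t 0.
  by move=> tI; exact: is_delta_deriveB (dH t tI) (dF t tI).
have [rs|/ltW sr] := leP r s.
  have := @delta_derive0_cst T _ r s cT Tr Ts rs.
  rewrite min_l// max_r// in dHF => /(_ _ dHF); lra.
have := @delta_derive0_cst T _ s r cT Ts Tr sr.
rewrite min_r// max_l// in dHF => /(_ _ dHF); lra.
Qed.

Lemma nabla_intE T h F r s : closed T -> T r -> T s ->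
  (forall t, ts_itv T (Num.min r s) (Num.max r s) t ->
    is_nabla_derive T F t (h t)) ->
  nabla_int T h r s = F s - F r.
Proof.
move=> cT Tr Ts dF; rewrite /nabla_int.
set H := xget _ _.
have dH t : ts_itv T (Num.min r s) (Num.max r s) t -> is_nabla_derive T H t (h t).
  by move: t; rewrite /H; case: xgetP => [? _|/(_ F)/(_ dF)].
move: H dH => H dH.
(* Constancy is known for delta derivatives, so the difference of the antiderivatives is moved to
   the reflected scale, where the bounds change order. *)
pose T' := [set - x | x in T].
have dHF t : ts_itv T (Num.min r s) (Num.max r s) (- t) ->
    is_delta_derive T' (fun x => H (- x) - F (- x)) t 0.
  move=> tI; rewrite -(opprK t); apply: (@is_delta_deriveB _ _ _ _ (- h (- t))).
    exact/is_nabla_derive_opp/dH.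
  exact/is_nabla_derive_opp/dF.
have cT' : closed T' by exact: closedN.
have Tr' : T' (- r) by exists r.
have Ts' : T' (- s) by exists s.
have dHF' x y : x <= y -> (forall t, ts_itv T x y t ->
    ts_itv T (Num.min r s) (Num.max r s) t) ->
    forall t, ts_itv T' (- y) (- x) t ->
    is_delta_derive T' (fun x => H (- x) - F (- x)) t 0.
  move=> xy sub t [Tt /=]; rewrite in_itv/= => /andP[yt tx].
  apply: dHF; apply: sub; split; first by rewrite -oppsetE.
  by rewrite /= in_itv/=; lra.
have [rs|/ltW sr] := leP r s.
  have := @delta_derive0_cst T' _ _ _ cT' Ts' Tr' _ (dHF' r s rs _).
  rewrite min_l// max_r// lerN2 !opprK => /(_ rs (fun _ => id)); lra.
have := @delta_derive0_cst T' _ _ _ cT' Tr' Ts' _ (dHF' s r sr _).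
rewrite min_r// max_l// lerN2 !opprK => /(_ sr (fun _ => id)); lra.
Qed.

Local Notation mu := (@lebesgue_measure R).

Lemma monotone_primitive (phi : R -> R) c :
  {homo phi : x y / x <= y} ->
  exists F : R -> R, forall x y k, c <= x -> x <= y ->
    ((forall u, x <= u < y -> phi u <= k) -> F y - F x <= k * (y - x)) /\
    ((forall u, x <= u < y -> k <= phi u) -> k * (y - x) <= F y - F x).
Proof.
move=> phi_nd.
have itg (psi : R -> R) (a b : itv_bound R) x y : {homo psi : x y / x <= y} ->
    [set` Interval a b] `<=` `[x, y]%classic ->
    mu.-integrable [set` Interval a b] (EFin \o psi).
  move=> psi_nd sub; apply: (@integrableS _ _ _ mu `[x, y]%classic) => //.
  apply: measurable_bounded_integrable => //.
  - by rewrite /= lebesgue_measure_itv/=; case: ifP; rewrite ?ltry.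
  - exact: nondecreasing_measurable.
  - exists (`|psi x| + `|psi y|); split; first exact: num_real.
    move=> M /ltW PM u /=; rewrite in_itv/= => /andP[xu uy].
    apply: le_trans PM; rewrite ler_norml.
    have := psi_nd _ _ xu; have := psi_nd _ _ uy.
    have := ler_norm (psi y); have := ler_norm (- psi x); rewrite normrN.
    have := normr_ge0 (psi y); have := normr_ge0 (psi x); lra.
exists (fun y => \int[mu]_(u in `[c, y]) phi u)%R => x y k cx xy.
rewrite Rintegral_itvB ?bnd_simp//; last exact: (itg _ _ _ c y).
have mufin : fine (mu `]x, y[%classic) = y - x.
  rewrite /= lebesgue_measure_itv/= lte_fin; case: ltgtP xy => // ->.
  by rewrite subrr.
have sub : `]x, y[ `<=` `[x, y]%classic.
  by move=> u /=; rewrite !in_itv/= => /andP[/ltW-> /ltW->].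
have kI : mu.-integrable `]x, y[%classic (EFin \o cst k) by exact: itg sub.
have phiI : mu.-integrable `]x, y[%classic (EFin \o phi) by exact: itg sub.
rewrite -Rintegral_itv_bndo_bndc// -mufin -Rintegral_cst//.
by split=> phik; apply: le_Rintegral => // u /=;
  rewrite in_itv/= => /andP[/ltW xu uy]; apply: phik; rewrite xu.
Qed.

End Antiderivatives.

(** * Existence of antiderivatives of monotone functions *)

Section Existence.
Context {R : realType}.
Set Implicit Arguments.
Unset Strict Implicit.
Implicit Types (T B : set R) (h F H : R -> R) (r s t x y l : R).

Definition continuous_on (A : set R) h := forall t, A t ->
  forall e : R, 0 < e -> exists2 d : R, 0 < d &
    forall s, A s -> `|s - t| < d -> `|h s - h t| <= e.

Lemma ts_itvE T r s t : ts_itv T r s t <-> T t /\ r <= t <= s.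
Proof. by rewrite /ts_itv; split=> -[Tt /=]; rewrite in_itv. Qed.

(** The function [h] is extended to the line by [h \o p], where [p x] is the last point of the
    interval up to [x]. The extension is nondecreasing and constant across gaps, and its Lebesgue
    primitive is the antiderivative. On [[x, y[] its values lie between [h x] and [h (rho T y)],
    hence the bounds on increments. *)
Lemma exists_delta_antiderivative T r s h :
  closed T -> T r -> T s -> r <= s ->
  (forall x y, ts_itv T r s x -> ts_itv T r s y -> x <= y -> h x <= h y) ->
  continuous_on (ts_itv T r s) h ->
  exists H,
    (forall t, ts_itv T r s t -> is_delta_derive T H t (h t)) /\
    (forall x y, ts_itv T r s x -> ts_itv T r s y -> x < y ->
       h x * (y - x) <= H y - H x <= h (rho T y) * (y - x)).
Proof.
move=> cT Tr Ts rs h_nd h_cont.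
pose A := ts_itv T r s.
(* The maximum keeps [r] in the set, so that [p x = r] for [x] to the left of [r]. *)
pose below x := A `&` [set u | u <= Num.max x r].
pose p x := sup (below x).
have Ar : A r by apply/ts_itvE; rewrite lexx.
have As : A s by apply/ts_itvE; rewrite lexx rs.
have belowr x : below x r by split=> //=; rewrite le_max lexx orbT.
have below_ub x : has_ubound (below x).
  by exists s => u [/ts_itvE[_ /andP[_ us]] _].
have p_ge t x : A t -> t <= x -> t <= p x.
  move=> At tx; apply: ub_le_sup => //; split=> //=.
  by rewrite le_max tx.
have p_le x : p x <= Num.max x r.
  by apply: ge_sup; [exists r|move=> u []].
have pA x : A (p x).
  apply/ts_itvE; split.
    by apply: closed_sup_sub => //; [move=> u [/ts_itvE[]] | exists r].
  rewrite ub_le_sup//=; apply: ge_sup; first by exists r.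
  by move=> u [/ts_itvE[_ /andP[]]].
have p_nd : {homo p : x y / x <= y}.
  move=> x y xy; apply: ge_sup; first by exists r.
  move=> u [Au /= ux]; apply: ub_le_sup => //; split=> //=.
  move: ux; rewrite !le_max => /orP[ux|->]; last by rewrite orbT.
  by rewrite (le_trans ux).
have Ale t : A t -> r <= t by case/ts_itvE => _ /andP[].
have AT t : A t -> T t by case/ts_itvE.
have p_id t : A t -> p t = t.
  move=> At; apply/eqP; rewrite eq_le p_ge// andbT.
  by have := p_le t; rewrite max_l// Ale.
have p_gap t x : A t -> t <= x < sigma T t -> p x = t.
  move=> At /andP[tx xt]; apply/eqP; rewrite eq_le p_ge// andbT leNgt.
  apply/negP => /(sigma_le (AT _ (pA x))).
  by have := p_le x; rewrite max_l; [lra|exact: le_trans (Ale t At) tx].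
(* The derivative at [t] also tests points of [T] outside [[r, s]]. On [T], [p] is the projection
   onto that interval and does not increase the distance to [t]. *)
have p_dist t x : A t -> T x -> `|p x - t| <= `|x - t|.
  move=> At Tx; have /ts_itvE[_ /andP[rt ts]] := At.
  have /ts_itvE[_ /andP[rp ps]] := pA x.
  have [xr|rx] := ltP x r.
    have := p_le x; rewrite max_r ?(ltW xr)// => pr.
    by rewrite !ler0_norm; lra.
  have [xs|sx] := leP x s; first by rewrite p_id//; apply/ts_itvE; rewrite rx.
  by have pxs := p_ge s x As (ltW sx); rewrite !ger0_norm; lra.
have hp_nd : {homo h \o p : x y / x <= y}.
  by move=> x y xy; exact: h_nd (pA x) (pA y) (p_nd _ _ xy).
(* The base point leaves room for points of [T] before [r]; the radius, at most 1, keeps them to its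
   right. *)
have [H HP] := monotone_primitive (r - 1) hp_nd.
exists H; split=> [t At|x y Ax Ay xy].
  have /ts_itvE[Tt /andP[rt ts]] := At.
  apply/within_slope_cvgP => e e0.
  have [d d0 dP] := h_cont t At e e0.
  exists (Num.min d 1); first by rewrite lt_min d0 ltr01.
  move=> x Tx; rewrite lt_min => /andP[xd x1].
  have := dP (p x) (pA x) (le_lt_trans (p_dist t x At Tx) xd).
  move: x1; rewrite ltr_distl => /andP[x1 _]; rewrite ler_distl => /andP[hx1 hx2].
  have := sigma_ge T t => tsig.
  (* Between [x] and [sigma T t], in either order, the extension stays between [h (p x)] and [h t],
     which differ by at most [e]. *)
  have [xt|tx] := leP x t.
    have [|up lo] := HP x (sigma T t) (h t) _ (le_trans xt tsig); first lra.
    have {up} up : H (sigma T t) - H x <= h t * (sigma T t - x).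
      apply: up => u /andP[xu us] /=; have [tu|ut] := leP t u.
        by rewrite (p_gap t)// tu.
      by have := hp_nd _ _ (ltW ut); rewrite /= (p_id t At).
    have [|_ {}lo] := HP x (sigma T t) (h (p x)) _ (le_trans xt tsig); first lra.
    have {lo} lo : h (p x) * (sigma T t - x) <= H (sigma T t) - H x.
      by apply: lo => u /andP[xu us] /=; exact: hp_nd.
    rewrite (ger0_norm (_ : 0 <= sigma T t - x)); last by lra.
    have hp : (h t - e) * (sigma T t - x) <= h (p x) * (sigma T t - x).
      by rewrite ler_wpM2r//; lra.
    by rewrite ler_norml; lra.
  have sx : sigma T t <= x by exact: sigma_le.
  have [|up _] := HP (sigma T t) x (h (p x)) _ sx; first lra.
  have {}up : H x - H (sigma T t) <= h (p x) * (x - sigma T t).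
    by apply: up => u /andP[_ /ltW ux]; exact: hp_nd.
  have [|_ lo] := HP (sigma T t) x (h t) _ sx; first lra.
  have {}lo : h t * (x - sigma T t) <= H x - H (sigma T t).
    apply: lo => u /andP[su _] /=; apply: (h_nd _ _ At (pA u)).
    by apply: p_ge => //; exact: le_trans su.
  rewrite (ler0_norm (_ : sigma T t - x <= 0)); last by lra.
  have hp : h (p x) * (x - sigma T t) <= (h t + e) * (x - sigma T t).
    by rewrite ler_wpM2r//; lra.
  by rewrite ler_norml; lra.
have cx : r - 1 <= x by have := Ale x Ax; lra.
apply/andP; split.
  have [_ lo] := HP x y (h x) cx (ltW xy).
  by apply: lo => u /andP[xu _] /=; apply: (h_nd _ _ Ax (pA u)); exact: p_ge.
have [up _] := HP x y (h (rho T y)) cx (ltW xy).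
apply: up => u /andP[xu uy] /=; have Ty := AT y Ay.
have ry : A (rho T y).
  apply/ts_itvE; split; first exact: rho_in.
  have /ts_itvE[_ /andP[_ ys]] := Ay.
  by rewrite (le_trans (Ale x Ax) (rho_ge (AT x Ax) xy)) (le_trans (rho_le T y)).
apply: (h_nd _ _ (pA u) ry); apply: rho_ge; first exact: AT.
by have := p_le u; rewrite max_l; [lra|exact: le_trans (Ale x Ax) xu].
Qed.

Lemma ts_itv_opp T r s t :
  ts_itv [set - x | x in T] (- s) (- r) t <-> ts_itv T r s (- t).
Proof.
by split=> /ts_itvE[Tt rst]; apply/ts_itvE; move: Tt;
  rewrite oppsetE => ?; split=> //; lra.
Qed.

(** Negating both argument and value keeps [h] nondecreasing, so the delta case applies on the
    reflected scale. *)
Lemma exists_nabla_antiderivative T r s h :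
  closed T -> T r -> T s -> r <= s ->
  (forall x y, ts_itv T r s x -> ts_itv T r s y -> x <= y -> h x <= h y) ->
  continuous_on (ts_itv T r s) h ->
  exists H,
    (forall t, ts_itv T r s t -> is_nabla_derive T H t (h t)) /\
    (forall x y, ts_itv T r s x -> ts_itv T r s y -> x < y ->
       h (sigma T x) * (y - x) <= H y - H x <= h y * (y - x)).
Proof.
move=> cT Tr Ts rs h_nd h_cont.
have [||||||H [dH bH]] := @exists_delta_antiderivative [set - x | x in T]
    (- s) (- r) (fun x => - h (- x)).
- exact: closedN.
- by exists s.
- by exists r.
- by rewrite lerN2.
- move=> x y /ts_itv_opp Tx /ts_itv_opp Ty xy.
  by rewrite lerN2 h_nd// lerN2.
- move=> t /ts_itv_opp Tt e e0; have [d d0 dP] := h_cont _ Tt e e0.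
  exists d => // x /ts_itv_opp Tx xd; rewrite -normrN opprB opprK addrC.
  apply: dP => //; move: xd; rewrite -normrN; congr (`|_| < _); ring.
exists (fun x => H (- x)); split=> [t Tt|x y Tx Ty xy].
  apply/is_nabla_derive_opp.
  have -> : (fun x => H (- - x)) = H by apply/funext => x; rewrite opprK.
  by rewrite -{2}(opprK t); apply: dH; apply/ts_itv_opp; rewrite opprK.
have := bH (- y) (- x); rewrite rho_opp !opprK ltrN2 => /(_ _ _ xy).
have Ty' : ts_itv [set - x | x in T] (- s) (- r) (- y).
  by apply/ts_itv_opp; rewrite opprK.
have Tx' : ts_itv [set - x | x in T] (- s) (- r) (- x).
  by apply/ts_itv_opp; rewrite opprK.
by move=> /(_ Ty' Tx') /andP[b1 b2]; apply/andP; split; lra.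
Qed.

End Existence.

(** * The increasing case *)

Section YoungIncreasing.
Context {R : realType}.
Set Implicit Arguments.
Unset Strict Implicit.
Implicit Types (T B : set R) (h F H : R -> R) (r s t x y l : R).

Section Young.
Context (T : set R) (r s : R) (f g : R -> R).
Hypotheses (cT : closed T) (Tr : T r) (Ts : T s) (rs : r <= s).
Let A := ts_itv T r s.
Let B := f @` A.
Hypothesis cB : closed B.
Hypothesis gK : forall t, A t -> g (f t) = t.

(** This settles the equality cases. Monotonicity enters only after it, so it serves decreasing [f]
    as well. *)
Lemma young_gap_eq0 a b : A a -> B b ->
  (g b - a) * (b - f (rho T a)) = 0 <-> b = f (rho T a) \/ b = f a.
Proof.
move=> Aa [t At <-]; rewrite gK//; split.
  move=> /eqP; rewrite mulf_eq0 !subr_eq0 => /orP[/eqP ->|/eqP]; first by right.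
  by left.
move=> [->|/(congr1 g)]; first by rewrite subrr mulr0.
by rewrite !gK// => ->; rewrite subrr mul0r.
Qed.

Hypothesis f_inc : forall x y, ts_itv T (rho T r) s x ->
  ts_itv T (rho T r) s y -> x < y -> f x < f y.
Hypothesis f_cont : continuous_on A f.

Let widen t : A t -> ts_itv T (rho T r) s t.
Proof.
move=> /ts_itvE[Tt /andP[rt ts]]; apply/ts_itvE; split => //.
by rewrite ts (le_trans (rho_le T r)).
Qed.

(** At [t = r] the backward jump may leave [A], which is why monotonicity is assumed from [rho T r]
    on. *)
Let widen_rho t : A t -> ts_itv T (rho T r) s (rho T t).
Proof.
move=> /ts_itvE[Tt /andP[rt ts]]; apply/ts_itvE; split; first exact: rho_in.
rewrite (le_trans (rho_le T t) ts) andbT.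
move: rt; rewrite le_eqVlt => /predU1P[->//|rt].
exact: le_trans (rho_le T r) (rho_ge Tr rt).
Qed.

Let f_incA x y : A x -> A y -> x < y -> f x < f y.
Proof. by move=> /widen Ax /widen Ay; exact: f_inc. Qed.

Let f_ndA x y : A x -> A y -> x <= y -> f x <= f y.
Proof.
by move=> Ax Ay; rewrite le_eqVlt => /predU1P[->//|/(f_incA Ax Ay)/ltW].
Qed.

Let f_ltA x y : A x -> A y -> f x < f y -> x < y.
Proof. by move=> Ax Ay; rewrite !ltNge; apply: contraNN; exact: f_ndA. Qed.

Let f_rho_le t : A t -> f (rho T t) <= f t.
Proof.
move=> At; have := rho_le T t; rewrite le_eqVlt => /predU1P[->//|rt].
by apply/ltW/f_inc => //; [exact: widen_rho|exact: widen].
Qed.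

Let Ar : A r. Proof. by apply/ts_itvE; rewrite lexx. Qed.
Let As : A s. Proof. by apply/ts_itvE; rewrite lexx rs. Qed.

Let BE : ts_itv B (f r) (f s) = B.
Proof.
apply/seteqP; split=> [y /ts_itvE[]//|_ [t At <-]].
have /ts_itvE[_ /andP[rt ts]] := At.
by apply/ts_itvE; split; [exists t|rewrite !f_ndA].
Qed.

(* Only the closedness of the domain is used: a point [t - e] below which
   [A] is nonempty is dominated by the largest point of [A] below it. *)
Lemma inverse_continuous_on : continuous_on B g.
Proof.
move=> _ [t At <-] e e0.
have cA : closed A by apply: closedI => //; exact: itv_closed.
have [d1 d10 dP1] : exists2 d : R, 0 < d &
    forall u, A u -> u <= t - e -> f u <= f t - d.
  have [[u0 [Au0 u0t]]|no] := pselect (exists u, A u /\ u <= t - e); last first.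
    by exists 1 => // u Au ut; exfalso; apply: no; exists u.
  pose E := A `&` [set u | u <= t - e].
  have Eub : has_ubound E by exists (t - e) => u [].
  have Au1 : A (sup E) by apply: closed_sup_sub => //; [move=> u []|exists u0].
  have u1 : sup E <= t - e by apply: ge_sup; [exists u0|move=> u []].
  exists (f t - f (sup E)); first by rewrite subr_gt0; apply: f_incA => //; lra.
  by move=> u Au ut; rewrite subKr; apply: f_ndA => //; exact: ub_le_sup.
have [d2 d20 dP2] : exists2 d : R, 0 < d &
    forall u, A u -> t + e <= u -> f t + d <= f u.
  have [[u0 [Au0 u0t]]|no] := pselect (exists u, A u /\ t + e <= u); last first.
    by exists 1 => // u Au ut; exfalso; apply: no; exists u.
  pose E := A `&` [set u | t + e <= u].
  have Elb : has_lbound E by exists (t + e) => u [].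
  have Au1 : A (inf E) by apply: closed_inf_sub => //; [move=> u []|exists u0].
  have u1 : t + e <= inf E by apply: lb_le_inf; [exists u0|move=> u []].
  exists (f (inf E) - f t); first by rewrite subr_gt0; apply: f_incA => //; lra.
  by move=> u Au ut; rewrite subrKC; apply: f_ndA => //; exact: ge_inf.
exists (Num.min d1 d2); first by rewrite lt_min d10.
move=> _ [u Au <-]; rewrite !gK// lt_min => /andP[].
rewrite ltr_distl => /andP[h1 _]; rewrite ltr_distl => /andP[_ h2].
rewrite ler_distl; apply/andP; split; rewrite leNgt; apply/negP => /ltW.
  by move=> /(dP1 u Au); lra.
by move=> /(dP2 u Au); lra.
Qed.

Lemma young_increasing : exists F G m,
  [/\ forall t, A t -> is_delta_derive T F t (f t),
      forall y, B y -> is_nabla_derive B G y (g y) &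
      forall a b, A a -> B b ->
        0 <= F a + G b - a * b - m <= (g b - a) * (b - f (rho T a))].
Proof.
have Bf t : A t -> B (f t) by exists t.
have [F [dF bF]] := exists_delta_antiderivative cT Tr Ts rs f_ndA f_cont.
have [|||G []] :=
  @exists_nabla_antiderivative _ B (f r) (f s) g cB (Bf r Ar) (Bf s As).
- exact: f_ndA.
- move=> x y; rewrite BE => -[u Au <-] [v Av <-]; rewrite !gK//.
  by rewrite !leNgt; apply: contraNN; exact: f_incA.
- by rewrite BE; exact: inverse_continuous_on.
rewrite BE => dG bG.
have {}bG x y : A x -> A y -> x < y -> f x < f y ->
    g (sigma B (f x)) * (f y - f x) <= G (f y) - G (f x) <= y * (f y - f x).
  by move=> Ax Ay xy fxy; rewrite -[X in _ <= X * _]gK//; apply: bG => //; exact: Bf.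
(* Here [sigma B (f x)] is some [f u] with [x <= u]. If [x < u], minimality of [sigma T x]
   concludes. If [u = x], then [f x] is right-dense in [B], and a point of [B] just above [f x]
   would have its preimage inside the gap after [x]. *)
have sigmaB x y : A x -> A y -> x < y -> sigma T x <= g (sigma B (f x)).
  move=> Ax Ay xy; have [u Au fu] := sigma_in cB (Bf x Ax).
  have fxu : f x <= f u by rewrite fu sigma_ge.
  rewrite -fu gK//; have /ts_itvE[Tu _] := Au.
  move: fxu; rewrite le_eqVlt => /predU1P[fxu|]; last first.
    by move=> /(f_ltA Ax Au); exact: sigma_le.
  have /ts_itvE[Tx /andP[rx xs]] := Ax; have /ts_itvE[Ty /andP[ry ys]] := Ay.
  rewrite leNgt; apply/negP.
  have -> : u = x by rewrite -(gK Au) -fxu gK.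
  move=> xsig; have Asig : A (sigma T x).
    apply/ts_itvE; split; first exact: sigma_in.
    by rewrite (le_trans rx (ltW xsig)) (le_trans (sigma_le Ty xy)).
  have fxsig := f_incA Ax Asig xsig.
  have d0 : 0 < f (sigma T x) - f x by rewrite subr_gt0.
  have [|_ [v Av <-]] := sigma_dense (Bf _ Asig) fxsig _ d0.
    by rewrite -fu -fxu.
  rewrite subrKC => /andP[/(f_ltA Ax Av) xv /(f_ltA Av Asig)].
  by have /ts_itvE[Tv _] := Av; rewrite ltNge sigma_le.
pose M t := F t + G (f t) - t * f t.
(* The increment of [F] lies between [f x] and [f y] times [y - x], that of [G] between [x] and [y]
   times [f y - f x]. Subtracting the increment of [t * f t] leaves the product of the two
   increments as error. *)
have M_step x y : A x -> A y -> x < y ->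
    `|M y - M x| <= (y - x) * (f y - f x).
  move=> Ax Ay xy; have fxy := f_incA Ax Ay xy.
  have /andP[F1 F2] := bF x y Ax Ay xy.
  have /andP[G1 G2] := bG x y Ax Ay xy fxy.
  have sx := le_trans (sigma_ge T x) (sigmaB x y Ax Ay xy).
  have fr := f_rho_le Ay.
  rewrite /M ler_norml; apply/andP; split; nra.
(* Across a gap the bounds collapse: [F] grows by [f x * (y - x)] and [G] by [y * (f y - f x)], in
   total the increment of [t * f t]. *)
have M_jump x y : A x -> A y -> y = sigma T x -> x < y -> M y = M x.
  move=> Ax Ay yE xy; have fxy := f_incA Ax Ay xy.
  have /ts_itvE[Tx _] := Ax.
  have /andP[F1 F2] := bF x y Ax Ay xy.
  have /andP[G1 G2] := bG x y Ax Ay xy fxy.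
  have sx := sigmaB x y Ax Ay xy; rewrite -yE in sx.
  have rE : rho T y = x by rewrite yE rho_sigma// -yE.
  rewrite rE in F2.
  have G3 : y * (f y - f x) <= g (sigma B (f x)) * (f y - f x).
    by rewrite ler_wpM2r//; lra.
  rewrite /M; lra.
have M_cst t : A t -> M t = M r.
  move=> At; have /ts_itvE[Tt /andP[rt ts]] := At.
  have At' x : T x -> r <= x <= t -> A x.
    by move=> Tx /andP[rx xt]; apply/ts_itvE; rewrite rx (le_trans xt).
  apply/eqP; rewrite -subr_eq0; apply/eqP.
  apply: (@le_eps_mul_eq0 _ _ (f t - f r)) => [|e e0].
    by rewrite subr_ge0 f_ndA.
  (* Measuring the error by [f x - f r] suits [M_step]: over a step shorter than [e], its bound is
     at most [e] times the increment of [f], at right-dense and left-dense points alike. *)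
  apply: (@time_scale_induction _ T r t
    (fun x => `|M x - M r| <= e * (f x - f r))) => //.
  - by rewrite !subrr normr0 mulr0.
  - move=> x Tx /andP[rx xt] xsig Px.
    have Ax : A x by apply: At' => //; rewrite rx ltW.
    have Asig : A (sigma T x).
      by apply: At'; [exact: sigma_in|rewrite (le_trans rx (ltW xsig)) sigma_le].
    rewrite (M_jump x _ Ax Asig)//; apply: le_trans Px _.
    by rewrite ler_pM2l// lerB// f_ndA// ltW.
  - move=> x Tx /andP[rx xt] _ Px.
    have Ax : A x by apply: At' => //; rewrite rx ltW.
    exists (Num.min e (t - x)); first by rewrite lt_min e0 subr_gt0.
    move=> y Ty /andP[xy]; rewrite -ltrBlDl lt_min => /andP[ye yt].
    have Ay : A y by apply: At' => //; lra.
    have := M_step x y Ax Ay xy; have := f_incA Ax Ay xy.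
    have := ler_normD (M y - M x) (M x - M r); rewrite addrA subrK; nra.
  - move=> x Tx /andP[rx xt] left Px.
    have Ax : A x by apply: At' => //; rewrite xt ltW.
    have [y [Ty ry yd yx]] := left e e0.
    have Ay : A y by apply: At' => //; lra.
    have := Px y Ty; rewrite ry yx => /(_ isT).
    have := M_step y x Ay Ax yx; have := f_incA Ay Ax yx.
    have := ler_normD (M x - M y) (M y - M r); rewrite addrA subrK; nra.
exists F, G, (M r); split=> // a b Aa [t At <-]; rewrite gK// -(M_cst t At) /M.
(* With [b = f t] and [m = M t] the terms in [G] cancel. For [a < t] the result lies between
   [(t - a) * (f t - f (rho T t))] and [(t - a) * (f t - f a)]; for [t < a] the bounds on [F] are
   exactly those claimed. *)
rewrite (_ : _ - _ = F a - F t + (t - a) * f t); last by ring.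
have [at_|ta|->] := ltgtP a t.
- have /andP[F1 F2] := bF a t Aa At at_.
  have fr := f_rho_le At; have fa := f_rho_le Aa.
  apply/andP; split; nra.
- have /andP[F1 F2] := bF t a At Aa ta.
  apply/andP; split; lra.
- by rewrite !subrr !mul0r addr0 lexx.
Qed.

End Young.

End YoungIncreasing.

(** * Reduction of the decreasing case *)

Section Conclusion.
Context {R : realType}.
Set Implicit Arguments.
Unset Strict Implicit.
Implicit Types (T B : set R) (h F H : R -> R) (r s t x y l : R).

Lemma within_continuous_on (A A' : set R) h :
  A' `<=` A -> {within A, continuous h} -> continuous_on A' h.
Proof.
move=> sub /subspace_continuousP hc t At e e0.
have /cvgrPdist_le/(_ e e0) := hc t (sub _ At).
rewrite near_withinE => /nbhs_ballP[d /= d0 dP]; exists d => // x Ax xd.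
by rewrite distrC; apply: dP; [rewrite /ball/= distrC|exact: sub].
Qed.

(* [w] and [w'] stand for [F a + G b - a b - m] at the upper and at the lower
   end points, [u] and [u'] for their upper bounds. *)
Lemma sandwich_sub (w w' u u' lo mid up : R) (P P' : Prop) :
  0 <= w <= u -> 0 <= w' <= u' -> (u = 0 <-> P) -> (u' = 0 <-> P') ->
  lo = - u' -> mid = w - w' -> up = u ->
  (lo <= mid /\ mid <= up) /\ (lo = mid /\ mid = up <-> P' /\ P).
Proof.
move=> /andP[w0 wu] /andP[w'0 wu'] <- <- -> -> ->; split; first by split; lra.
(* The first equality forces [w = 0] and [w' = u'], the second [w = u] and [w' = 0], so together
   they make all four vanish. *)
by split=> -[h1 h2]; split; lra.
Qed.

Lemma ts_itv_minmax_sub T r s x y t : ts_itv T r s x -> ts_itv T r s y ->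
  ts_itv T (Num.min x y) (Num.max x y) t -> ts_itv T r s t.
Proof.
move=> /ts_itvE[_ /andP[rx xs]] /ts_itvE[_ /andP[ry ys]].
move=> /ts_itvE[Tt /andP[h1 h2]]; apply/ts_itvE; split=> //.
rewrite (le_trans _ h1) ?le_min ?rx//= (le_trans h2)//.
by rewrite ge_max xs.
Qed.

End Conclusion.

Theorem theorem2p3 (R : realType) (T Tt : set R) (alpha1 alpha2 beta1 beta2 : R)
    (f finv : R -> R)
    (T_ts : time_scale T)
    (alpha1T : T alpha1) (alpha2T : T alpha2) (alpha12 : alpha1 < alpha2)
    (TtE : Tt = f @` ts_itv T alpha1 alpha2)
    (Tt_ts : time_scale Tt)
    (f_range : forall t, ts_itv T alpha1 alpha2 t -> ts_itv Tt beta1 beta2 (f t))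
    (f_cont : {within ts_itv T (rho T alpha1) alpha2, continuous f})
    (finvK : forall t, ts_itv T alpha1 alpha2 t -> finv (f t) = t) :
  ((forall s t, ts_itv T (rho T alpha1) alpha2 s ->
      ts_itv T (rho T alpha1) alpha2 t -> s < t -> f s < f t) ->
    forall a ah b bh : R,
      ts_itv T alpha1 alpha2 a -> ts_itv T alpha1 alpha2 ah ->
      ts_itv Tt beta1 beta2 b -> ts_itv Tt beta1 beta2 bh ->
      let lower := (finv bh - ah) * (f (rho T ah) - bh) in
      let middle := delta_int T f ah a + nabla_int Tt finv bh b
                    - a * b + ah * bh in
      let upper := (finv b - a) * (b - f (rho T a)) in
      (lower <= middle /\ middle <= upper) /\
      ((lower = middle /\ middle = upper) <->
       ((bh = f (rho T ah) \/ bh = f ah) /\ (b = f (rho T a) \/ b = f a)))) /\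
  ((forall s t, ts_itv T (rho T alpha1) alpha2 s ->
      ts_itv T (rho T alpha1) alpha2 t -> s < t -> f t < f s) ->
    forall a ah b bh : R,
      ts_itv T alpha1 alpha2 a -> ts_itv T alpha1 alpha2 ah ->
      ts_itv Tt beta1 beta2 b -> ts_itv Tt beta1 beta2 bh ->
      let lower := (finv bh - ah) * (f (rho T ah) - bh) in
      let middle := delta_int T f ah a + delta_int Tt finv bh b
                    - a * b + ah * bh in
      let upper := (finv b - a) * (b - f (rho T a)) in
      (lower >= middle /\ middle >= upper) /\
      ((lower = middle /\ middle = upper) <->
       ((bh = f (rho T ah) \/ bh = f ah) /\ (b = f (rho T a) \/ b = f a)))).
Proof.
have [_ cT] := T_ts; have [_ cTt] := Tt_ts.
pose A := ts_itv T alpha1 alpha2.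
have AT t : A t -> T t by case.
have AE : alpha1 <= alpha2 by exact: ltW.
have sub : A `<=` ts_itv T (rho T alpha1) alpha2.
  move=> t /ts_itvE[Tt' /andP[h1 h2]]; apply/ts_itvE; split=> //.
  by rewrite h2 (le_trans (rho_le T alpha1)).
have f_contA := within_continuous_on sub f_cont.
have Beq : f @` A = Tt by rewrite TtE.
split=> f_mono a ah b bh Aa Aah [Bb _] [Bbh _] /=.
  have [|F [G [m [dF dG W]]]] :=
    young_increasing cT alpha1T alpha2T AE _ finvK f_mono f_contA.
    by rewrite Beq.
  rewrite -/A Beq in dG W.
  rewrite (@delta_intE _ T f F)//; [|exact: AT|exact: AT|]; last first.
    by move=> t /(ts_itv_minmax_sub Aah Aa); exact: dF.
  rewrite (@nabla_intE _ Tt finv G)//; last by move=> t [Ttt _]; exact: dG.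
  have W1 := W a b Aa Bb; have W2 := W ah bh Aah Bbh; rewrite -Beq in Bb Bbh.
  have gap := young_gap_eq0 finvK Aa Bb.
  have gap' := young_gap_eq0 finvK Aah Bbh.
  by apply: (sandwich_sub W1 W2 gap gap'); ring.
pose Tt' := [set - y | y in Tt].
have Beq' : (fun t => - f t) @` A = Tt'.
  rewrite /Tt' -Beq; apply/seteqP; split=> [_ [t At <-]|_ [_ [t At <-] <-]].
    by exists (f t) => //; exists t.
  by exists t.
have finvK' t : A t -> finv (- (- f t)) = t by rewrite opprK; exact: finvK.
have [|||F [G [m [dF dG W]]]] :=
    @young_increasing _ T alpha1 alpha2 (fun t => - f t) (fun y => finv (- y))
      cT alpha1T alpha2T AE _ finvK'.
- by rewrite -/A Beq'; exact: closedN.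
- by move=> x y Ax Ay xy; rewrite ltrN2; exact: f_mono.
- move=> t At e e0; have [d d0 dP] := f_contA t At e e0.
  by exists d => // x Ax xd; rewrite -opprD normrN; exact: dP.
rewrite -/A Beq' in dG W.
have Tt'K : [set - y | y in Tt'] = Tt.
  by apply/seteqP; split=> y; rewrite oppsetE /Tt' oppsetE opprK.
(* Reflection turns the nabla derivative on [Tt'] into a delta derivative on [Tt] of opposite sign,
   which the minus before [G] restores. *)
have dG' y : Tt y -> is_delta_derive Tt (fun x => - G (- x)) y (finv y).
  move=> Tty; have Tty' : Tt' (- y) by exists y.
  have /is_nabla_derive_opp/is_delta_derive_opp := dG _ Tty'.
  by rewrite !opprK Tt'K.
rewrite (@delta_intE _ T f (fun x => - F x))//; [|exact: AT|exact: AT|]; last first.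
  move=> t /(ts_itv_minmax_sub Aah Aa) At.
  by rewrite -(opprK (f t)); apply: is_delta_derive_opp; exact: dF.
rewrite (@delta_intE _ Tt finv (fun x => - G (- x)))//; last first.
  by move=> t [Ttt _]; exact: dG'.
have Bb' : Tt' (- b) by exists b.
have Bbh' : Tt' (- bh) by exists bh.
have W1 := W a _ Aa Bb'; have W2 := W ah _ Aah Bbh'; rewrite -Beq in Bb Bbh.
(* The gap of [- f] at [- y] is the opposite of the gap of [f] at [y]; this reverses the
   inequalities. *)
have gapN x y : finv (- - y) = finv y ->
    (finv (- - y) - x) * (- y - - f (rho T x)) =
    - ((finv y - x) * (y - f (rho T x))) by move=> ->; ring.
rewrite !gapN ?opprK// in W1 W2.
have gap := young_gap_eq0 finvK Aa Bb.
have gap' := young_gap_eq0 finvK Aah Bbh.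
have oppr0P (x : R) : - x = 0 <-> x = 0 by split; lra.
have [[lomid midup] eqs] := sandwich_sub W1 W2
  (iff_trans (oppr0P _) gap) (iff_trans (oppr0P _) gap') erefl erefl erefl.
split; first by split; lra.
apply: iff_trans eqs; split=> -[e1 e2]; split; lra.
Qed.
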